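(* Let $u_0, r \ge 1$ be integers with $\gcd(u_0, r) = 1$, and for each integer $k \ge 0$ put $u_k := u_0 + kr$. For each integer $n \ge 0$ let $L_n := \mathrm{lcm}(u_0, u_1, \ldots, u_n)$. Let $a, l \ge 2$ be any given integers. Then for any integer $\alpha \ge a$, if $r \ge \max(a, l-1)$, then for every integer $n \ge l\alpha r$ we have $$L_n \ge u_0\, r^{(l-1)\alpha + a - l}\,(r+1)^n.$$
   Context: Here $\mathrm{lcm}(u_0,\ldots,u_n)$ denotes the least common multiple of the positive integers $u_0, \ldots, u_n$. *)

(* Defs.v *)
From mathcomp Require Import all_boot.

Set Implicit Arguments.
Unset Strict Implicit.
Unset Printing Implicit Defensive.

Definition ap_term (u0 r k : nat) : nat := u0 + k * r.

Definition ap_lcm (u0 r n : nat) : nat :=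
  \big[lcmn/1%N]_(k < n.+1) ap_term u0 r k.

(* Main.v *)
Require Import Defs.
From mathcomp Require Import all_boot.
From mathcomp Require Import zify.

Set Implicit Arguments.
Unset Strict Implicit.
Unset Printing Implicit Defensive.

(* Write U(k, n) = u_k ... u_n.  Each U(k, n) divides (n-k)! r^(n-k) L_n, and it
   is coprime to r; hence if r^M divides (n-k)!, then U(k, n) divides
   ((n-k)! / r^M) L_n, that is, L_n >= r^M U(k, n) / (n-k)!.  Taking for k the
   index that maximises U(k, n) / (n-k)!, namely the least k with
   n < u_0 + k (r+1), one gets U(k, n) / (n-k)! >= u_0 (r+1)^n by induction on
   n, while n - k is still about n r / (r+1), so that r^M divides (n-k)! as soon
   as M (r+1) <= n. *)

Lemma ap_termS u r k : ap_term u r k.+1 = ap_term (u + r) r k.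
Proof. by rewrite /ap_term mulSn addnA. Qed.

Lemma ap_termD u r k i : ap_term (ap_term u r k) r i = ap_term u r (k + i).
Proof. by rewrite /ap_term mulnDl addnA. Qed.

Lemma ap_term_gt0 u r k : 0 < u -> 0 < ap_term u r k.
Proof. by rewrite /ap_term addn_gt0 => ->. Qed.

Lemma coprime_ap_term u r k : coprime (ap_term u r k) r = coprime u r.
Proof. by rewrite /ap_term /coprime addnC gcdnC gcdnMDl gcdnC. Qed.

(* Induction on m through r (m+1) = u_{m+1} - u_0, where the product of
   u_0, ..., u_{m+1} is both u_{m+1} times the product of the first m+1 terms
   and u_0 times the product of the last m+1 terms. *)
Lemma prod_ap_dvd u r m L :
  (forall i, i <= m -> ap_term u r i %| L) ->
  \prod_(i < m.+1) ap_term u r i %| m`! * r ^ m * L.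
Proof.
elim: m u => [|m IHm] u dvdL.
  by rewrite big_ord_recl big_ord0 muln1 !mul1n; apply: dvdL.
set P := \prod_(i < _) _.
have dvd_last : P %| ap_term u r m.+1 * (m`! * r ^ m * L).
  rewrite /P big_ord_recr /= mulnC dvdn_mul //.
  by apply: IHm => i lim; apply: dvdL; apply: leqW.
have dvd_first : P %| u * (m`! * r ^ m * L).
  rewrite /P big_ord_recl /= {1}/ap_term mul0n addn0 dvdn_mul //.
  under eq_bigr => i _ do rewrite ap_termS.
  by apply: IHm => i lim; rewrite -ap_termS; apply: dvdL.
have -> : m.+1`! * r ^ m.+1 * L =
    ap_term u r m.+1 * (m`! * r ^ m * L) - u * (m`! * r ^ m * L).
  by rewrite -mulnBl /ap_term addKn factS expnS; lia.
exact: dvdn_sub.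
Qed.

(** [m!] is a multiple of [r! (m-r)!], and [r!] supplies one factor [r]. *)
Lemma dvdn_exp_fact r M m : 0 < r -> M * r <= m -> r ^ M %| m`!.
Proof.
move=> r_gt0; elim: M m => [|M IHM] m; first by rewrite expn0 dvd1n.
rewrite mulSn => leMm; have le_rm : r <= m by lia.
rewrite -(bin_fact le_rm) expnS dvdn_mull // dvdn_mul //.
  by apply: dvdn_fact; rewrite r_gt0 leqnn.
by apply: IHM; lia.
Qed.

Lemma ap_term_dvd_lcm u r n k : k <= n -> ap_term u r k %| ap_lcm u r n.
Proof.
rewrite -ltnS => ltkn.
by rewrite /ap_lcm (bigD1 (Ordinal ltkn)) //= dvdn_lcml.
Qed.

Lemma ap_lcm_gt0 u r n : 0 < u -> 0 < ap_lcm u r n.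
Proof.
move=> u_gt0; rewrite /ap_lcm; elim/big_rec: _ => //= i x _ x_gt0.
by rewrite lcmn_gt0 ap_term_gt0.
Qed.

Lemma ap_lcm_ge u r k m M B :
    0 < u -> 0 < r -> coprime u r -> r ^ M %| m`! ->
    B * m`! <= \prod_(i < m.+1) ap_term u r (k + i) ->
  r ^ M * B <= ap_lcm u r (k + m).
Proof.
move=> u_gt0 r_gt0 cop_ur /dvdnP[q fact_m] leB.
set L := ap_lcm u r (k + m).
have q_gt0 : 0 < q by have := fact_gt0 m; rewrite fact_m muln_gt0 => /andP[].
set P := \prod_(i < _) _ in leB.
have cop_P e : coprime P (r ^ e).
  apply: coprimeXr; rewrite /P; elim/big_rec: _ => [|i x _ cop_x].
    exact: coprime1n.
  by rewrite coprimeMl coprime_ap_term cop_ur.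
have dvdP : P %| m`! * r ^ m * L.
  rewrite /P; under eq_bigr => i _ do rewrite -ap_termD.
  apply: prod_ap_dvd => i leim; rewrite ap_termD.
  by apply: ap_term_dvd_lcm; rewrite leq_add2l.
(* As [P] is coprime to [r], every power of [r] cancels, leaving [q = m! / r^M]. *)
have {}dvdP : P %| q * L.
  have : P %| r ^ (M + m) * (q * L) by rewrite expnD; move: dvdP; rewrite fact_m;
    congr (_ %| _); lia.
  by rewrite Gauss_dvdr.
have leP : P <= q * L.
  by apply: dvdn_leq => //; rewrite muln_gt0 q_gt0 ap_lcm_gt0.
rewrite -(leq_pmul2l q_gt0); apply: leq_trans leP; apply: leq_trans leB.
by rewrite fact_m; lia.
Qed.

(* The first two inequalities characterise k as the least index with
   n < u + k (r+1). *)
Lemma prod_ap_ge u r n : 0 < u ->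
  exists k m, [/\ k + m = n, n < u + k * r.+1,
    k * r.+1 <= n + r.+1 - u \/ k = 0 &
    u * r.+1 ^ n * m`! <= \prod_(i < m.+1) ap_term u r (k + i)].
Proof.
move=> u_gt0; elim: n => [|n [k [m [kmn lt_nk le_kn leP]]]].
  exists 0, 0; split=> //; [lia | by right |].
  by rewrite big_ord_recl big_ord0 /ap_term !muln1 mul0n addn0.
(* u_{n+1} / (n+1-k) >= r+1 since n+1 <= u + k (r+1). *)
have step : u * r.+1 ^ n.+1 * m.+1`! <= \prod_(i < m.+2) ap_term u r (k + i).
  rewrite big_ord_recr /= expnS factS.
  have -> : u * (r.+1 * r.+1 ^ n) * (m.+1 * m`!) =
    (u * r.+1 ^ n * m`!) * (r.+1 * m.+1) by lia.
  by apply: leq_mul => //; rewrite /ap_term; nia.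
have [lt_Snk|le_kSn] := ltnP n.+1 (u + k * r.+1).
  by exists k, m.+1; split=> //; lia.
exists k.+1, m; split; [lia | lia | left; lia |].
(* Here u_k = n + 1 - k = m + 1, so dropping u_k leaves the quotient
   unchanged. *)
have uk : ap_term u r k = m.+1 by rewrite /ap_term; lia.
rewrite -(leq_pmul2l (ltn0Sn m)) -{2}uk.
move: step; rewrite big_ord_recl /= addn0 factS.
under eq_bigr => i _ do rewrite /bump /= add1n addnS -addSn.
by congr (_ <= _); lia.
Qed.

Lemma ap_lcm_ge_expn u r n M :
    0 < u -> 0 < r -> coprime u r -> M * r.+1 <= n ->
  u * r ^ M * r.+1 ^ n <= ap_lcm u r n.
Proof.
move=> u_gt0 r_gt0 cop_ur leMn.
have [k [m [kmn _ le_kn leP]]] := prod_ap_ge r n u_gt0.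
(* Since [u >= 1], [m (r+1) >= n r - r > (M r - 1) (r+1)]. *)
have leMm : M * r <= m by case: le_kn => ?; nia.
rewrite -kmn in leP *.
have := ap_lcm_ge u_gt0 r_gt0 cop_ur (dvdn_exp_fact r_gt0 leMm) leP.
by congr (_ <= _); lia.
Qed.

Theorem theorem1p3 (u0 r : nat) (hu0 : 1 <= u0) (hr : 1 <= r)
    (hcop : gcdn u0 r = 1) (a l : nat) (ha : 2 <= a) (hl : 2 <= l)
    (alpha : nat) (halpha : a <= alpha) (hmax : maxn a (l - 1) <= r)
    (n : nat) (hn : l * alpha * r <= n) :
  u0 * r ^ ((l - 1) * alpha + a - l) * (r + 1) ^ n <= ap_lcm u0 r n.
Proof.
move: hmax; rewrite geq_max => /andP[le_ar le_lr].
rewrite addn1; apply: ap_lcm_ge_expn => //; first exact/eqP.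
apply: leq_trans hn.
(* The claim is (a - l) (r + 1) <= alpha (r - l + 1), trivial if a <= l. *)
have [s def_r] : exists s, r = l - 1 + s by exists (r - (l - 1)); lia.
have [le_al|lt_la] := leqP a l.
  apply: (@leq_trans ((l - 1) * alpha * r.+1)).
    by rewrite leq_mul2r leq_subLR addnC leq_add2r le_al orbT.
  by nia.
have : (a - l) * r.+1 <= alpha * s.
  (* Here [a s - (a-l) (r+1) = l (r+1-a)], which is nonnegative because [a <= r]. *)
  by apply: (@leq_trans (a * s)); nia.
by nia.
Qed.
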